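(* Let $\mathbf{x}$ be a set of probability predictions with corresponding outcomes $\mathbf{y}$. Let $\mathbf{x}'$ be $\mathbf{x}$ under LLO-adjustment by some $\delta$ and $\gamma$, i.e. $x_i'=c(x_i;\delta,\gamma)$. Then under the BIC approximation of the Bayes factor $BF_{\mathbf{x}'}$, $$(\hat\delta_{MLE},\hat\gamma_{MLE})=\operatorname*{argmax}_{(\delta,\gamma)}P_{\mathbf{x}'}(M_c\mid\mathbf{y}),$$ where $(\hat\delta_{MLE},\hat\gamma_{MLE})$ are the maximum likelihood estimates of $(\delta,\gamma)$ for the original predictions $\mathbf{x}$ and outcomes $\mathbf{y}$; that is, MLE recalibration (LLO-adjustment of $\mathbf{x}$ by $\hat\delta_{MLE}$ and $\hat\gamma_{MLE}$) maximizes the posterior probability of calibration.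
   Context: Here $\mathbf{x}=(x_1,\dots,x_n)$ is a vector of probability predictions from a single source and $\mathbf{y}=(y_1,\dots,y_n)$ is the vector of corresponding binary event outcomes ($y_i\in\{0,1\}$). The Linear Log Odds (LLO) recalibration function, with parameters $\delta>0$ and $\gamma\in\mathbb{R}$, is $$c(x_i;\delta,\gamma)=\frac{\delta x_i^\gamma}{\delta x_i^\gamma+(1-x_i)^\gamma}.$$ Applying it to predictions with some $\delta$ and $\gamma$ is called LLO-adjustment. For a prediction vector $\mathbf{z}$ (either $\mathbf{x}$ or $\mathbf{x}'$) and outcomes $\mathbf{y}$, the LLO likelihood is $$L(\delta,\gamma;\mathbf{z},\mathbf{y})=\prod_{i=1}^n c(z_i;\delta,\gamma)^{y_i}\,[1-c(z_i;\delta,\gamma)]^{1-y_i}.$$ The maximum likelihood estimates (MLEs) for $\mathbf{z}$ are the values of $\delta>0$ and $\gamma\in\mathbb{R}$ maximizing $L(\delta,\gamma;\mathbf{z},\mathbf{y})$; those for $\mathbf{z}=\mathbf{x}$ are denoted $\hat\delta_{MLE},\hat\gamma_{MLE}$. The well calibrated model $M_c$ has $\delta=\gamma=1$ (no adjustment); the uncalibrated model $M_u$ has $\delta>0$ and $\gamma\in\mathbb{R}$ free. $P(M_c)$ and $P(M_u)$ are the prior model probabilities, which do not depend on $\delta$ and $\gamma$. For a prediction vector $\mathbf{z}$, the posterior probability of calibration is $$P_{\mathbf{z}}(M_c\mid\mathbf{y})=\frac{1}{1+BF_{\mathbf{z}}\,\frac{P(M_u)}{P(M_c)}},$$ where $BF_{\mathbf{z}}$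 is the Bayes factor comparing $M_u$ to $M_c$. Its BIC approximation is $$BF_{\mathbf{z}}\approx\exp\left\{-\tfrac12\left(BIC_u-BIC_c\right)\right\},$$ with $$BIC_c=-2\log L(1,1;\mathbf{z},\mathbf{y}),\qquad BIC_u=2\log n-2\log L(\hat\delta^{\mathbf{z}},\hat\gamma^{\mathbf{z}};\mathbf{z},\mathbf{y}),$$ where $\hat\delta^{\mathbf{z}},\hat\gamma^{\mathbf{z}}$ are the MLEs for $\mathbf{z}$. In particular, for $\mathbf{z}=\mathbf{x}'$ the MLEs in $BIC_u$ are those computed for the adjusted predictions $\mathbf{x}'$.
   Formalization: The MLE of x is shown to maximize the posterior over all δ>0, γ∈ℝ, but the argmax set is shown equal to the MLE set only for γ≠0: at γ=0, δ=ȳ/(1−ȳ) the posterior is also maximal, so literal equality fails. Predictions are in (0,1), priors positive, an MLE of x is assumed to exist. *)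

(* Defs.v *)
From HB Require Import structures.
From mathcomp Require Import all_boot all_order all_algebra.
From mathcomp Require Import all_classical all_reals all_analysis.

Set Implicit Arguments.
Unset Strict Implicit.
Unset Printing Implicit Defensive.

Import Order.TTheory GRing.Theory Num.Theory.

Local Open Scope classical_set_scope.
Local Open Scope ring_scope.

(* The set of all maximizers of [f] over [D]; it may be empty or have several
   elements. *)
Definition argmax (R : realType) (T : Type) (D : set T) (f : T -> R) : set T :=
  [set p | D p /\ forall q, D q -> f q <= f p].

(* A parameter is a pair (delta, gamma). *)
Definition params (R : realType) : set (R * R) := [set p | 0 < p.1].

(* Meaningful for 0 < x < 1 only: [powR] has a conventional value at base 0. *)
Definition llo (R : realType) (p : R * R) (x : R) : R :=
  (p.1 * x `^ p.2) / (p.1 * x `^ p.2 + (1 - x) `^ p.2).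

Definition llo_adjust (R : realType) (n : nat) (p : R * R) (x : 'I_n -> R) :
    'I_n -> R :=
  fun i => llo p (x i).

Definition likelihood (R : realType) (n : nat) (p : R * R)
    (z : 'I_n -> R) (y : 'I_n -> bool) : R :=
  \prod_(i < n) (llo p (z i) ^+ y i * (1 - llo p (z i)) ^+ (1 - y i)%N).

Definition mles (R : realType) (n : nat) (z : 'I_n -> R) (y : 'I_n -> bool) :
    set (R * R) :=
  argmax (@params R) (fun p => likelihood p z y).

(* A chosen MLE. Its value enters below only through the likelihood at it,
   which is the same for all elements of [mles z y]; the default (1, 1) is
   used only if [mles z y] is empty. *)
Definition mle (R : realType) (n : nat) (z : 'I_n -> R) (y : 'I_n -> bool) :
    R * R :=
  xget (1, 1) (mles z y).

Definition BIC_c (R : realType) (n : nat) (z : 'I_n -> R) (y : 'I_n -> bool) :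
    R :=
  - 2 * ln (likelihood (1, 1) z y).

Definition BIC_u (R : realType) (n : nat) (z : 'I_n -> R) (y : 'I_n -> bool) :
    R :=
  2 * ln n%:R - 2 * ln (likelihood (mle z y) z y).

(* BIC approximation of the Bayes factor of M_u against M_c. *)
Definition BF (R : realType) (n : nat) (z : 'I_n -> R) (y : 'I_n -> bool) : R :=
  expR (- (1 / 2) * (BIC_u z y - BIC_c z y)).

(* [Pc] and [Pu] are the prior probabilities of M_c and M_u. *)
Definition posterior_calibrated (R : realType) (n : nat) (Pc Pu : R)
    (z : 'I_n -> R) (y : 'I_n -> bool) : R :=
  1 / (1 + BF z y * (Pu / Pc)).

(* Main.v *)
Require Import Defs.
From HB Require Import structures.
From mathcomp Require Import all_boot all_order all_algebra.
From mathcomp Require Import all_classical all_reals all_analysis.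
From mathcomp Require Import ring lra.

Set Implicit Arguments.
Unset Strict Implicit.
Unset Printing Implicit Defensive.

Import Order.TTheory GRing.Theory Num.Theory numFieldNormedType.Exports.

Local Open Scope classical_set_scope.
Local Open Scope ring_scope.

(** LLO maps are affine in log-odds, so they compose:
    c(c(x; p); q) = c(x; q o p), and L(q; x') = L(q o p; x) for x' = c(x; p).
    As (1, 1) is neutral, L(1, 1; x') = L(p; x), so BF_{x'} equals
    max_q L(q o p; x) / (n L(p; x)), which is always at least 1 / n, with
    equality exactly when no q o p beats p.  This holds when p is an MLE for x,
    and conversely when gamma <> 0, since then q o p ranges over all parameters.
    When gamma = 0 the vector x' is constant and its MLEs maximize
    t^k (1 - t)^(n - k) over ]0, 1[; a maximizer exists because 0 < k < n, as
    otherwise rescaling delta would improve any MLE for x. *)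

(** * Composition of LLO maps *)

Definition llo_comp (R : realType) (q p : R * R) : R * R :=
  (q.1 * p.1 `^ q.2, p.2 * q.2).

Lemma llo_comp_params (R : realType) (q p : R * R) :
  params q -> params p -> params (llo_comp q p).
Proof. by move=> q0 p0; rewrite /params /= mulr_gt0 // powR_gt0. Qed.

Lemma llo_comp1 (R : realType) (p : R * R) : params p -> llo_comp (1, 1) p = p.
Proof.
by case: p => d g; rewrite /params /llo_comp /= => d0; rewrite mul1r mulr1 powRr1 ?ltW.
Qed.

(** Composing with [p] multiplies the exponent by [p.2], so the exponent of [q] is solved first, and
    then its scale. *)
Lemma llo_compK (R : realType) (r p : R * R) : params r -> params p ->
  p.2 != 0 -> exists2 q, params q & llo_comp q p = r.
Proof.
case: r => d g; rewrite /params /= => d0 p0 g0.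
have P0 : 0 < p.1 `^ (g / p.2) by rewrite powR_gt0.
exists (d / p.1 `^ (g / p.2), g / p.2); first by rewrite /= divr_gt0.
by rewrite /llo_comp /= divfK ?gt_eqF // mulrC divfK.
Qed.

Lemma llo_denom_gt0 (R : realType) (p : R * R) (x : R) : params p -> 0 < x < 1 ->
  0 < p.1 * x `^ p.2 + (1 - x) `^ p.2.
Proof.
move=> p0 /andP[x0 x1].
by rewrite addr_gt0 ?mulr_gt0 ?powR_gt0 ?subr_gt0.
Qed.

Lemma onem_llo (R : realType) (p : R * R) (x : R) : params p -> 0 < x < 1 ->
  1 - llo p x = (1 - x) `^ p.2 / (p.1 * x `^ p.2 + (1 - x) `^ p.2).
Proof.
move=> p0 x01; have S0 := llo_denom_gt0 p0 x01.
by rewrite /llo; field; rewrite gt_eqF.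
Qed.

Lemma llo_itv (R : realType) (p : R * R) (x : R) : params p -> 0 < x < 1 ->
  0 < llo p x < 1.
Proof.
move=> p0 x01; have S0 := llo_denom_gt0 p0 x01.
have /andP[x0 x1] := x01.
apply/andP; split; first by rewrite divr_gt0 ?mulr_gt0 ?powR_gt0.
by rewrite -subr_gt0 onem_llo // divr_gt0 ?powR_gt0 ?subr_gt0.
Qed.

Lemma llo_llo (R : realType) (q p : R * R) (x : R) :
  params q -> params p -> 0 < x < 1 -> llo q (llo p x) = llo (llo_comp q p) x.
Proof.
move=> q0 p0 x01; have S0 := llo_denom_gt0 p0 x01.
have /andP[x0 x1] := x01.
have /andP[l0 l1] := llo_itv p0 x01.
have M0 := llo_denom_gt0 (llo_comp_params q0 p0) x01.
have N0 := llo_denom_gt0 q0 (llo_itv p0 x01).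
(* [S] is the common denominator of [llo p x] and its complement. Raised to the power [q.2], it
   factors out of both terms of the composed map and cancels. *)
set S := p.1 * x `^ p.2 + (1 - x) `^ p.2 in S0.
have eA : p.1 * x `^ p.2 = llo p x * S by rewrite /llo divfK // gt_eqF.
have eB : (1 - x) `^ p.2 = (1 - llo p x) * S.
  by rewrite onem_llo // divfK // gt_eqF.
have eA' : p.1 `^ q.2 * x `^ (p.2 * q.2) = llo p x `^ q.2 * S `^ q.2.
  by rewrite powRrM -!powRM ?powR_ge0 ?eA ?ltW.
have eB' : (1 - x) `^ (p.2 * q.2) = (1 - llo p x) `^ q.2 * S `^ q.2.
  by rewrite powRrM eB powRM ?subr_ge0 ?ltW.
rewrite [RHS]/llo /llo_comp /= -(mulrA q.1) eA' eB' mulrA -mulrDl.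
by rewrite -mulf_div divff ?mulr1 // gt_eqF // powR_gt0.
Qed.

Lemma ltr_llo (R : realType) (d e g x : R) : 0 < d -> d < e -> 0 < x < 1 ->
  llo (d, g) x < llo (e, g) x.
Proof.
move=> d0 de x01; have e0 := lt_trans d0 de.
have /andP[x0 x1] := x01.
have := @llo_denom_gt0 _ (d, g) x d0 x01; have := @llo_denom_gt0 _ (e, g) x e0 x01.
rewrite /llo /= => E0 D0.
rewrite ltr_pdivrMr // mulrAC ltr_pdivlMr //.
have X0 : 0 < x `^ g by rewrite powR_gt0.
have Y0 : 0 < (1 - x) `^ g by rewrite powR_gt0 ?subr_gt0.
rewrite -subr_gt0.
have -> : e * x `^ g * (d * x `^ g + (1 - x) `^ g)
   - d * x `^ g * (e * x `^ g + (1 - x) `^ g)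
   = (e - d) * (x `^ g * (1 - x) `^ g) by ring.
by rewrite !mulr_gt0 ?subr_gt0.
Qed.

Lemma llo0r (R : realType) (d x : R) : llo (d, 0) x = d / (d + 1).
Proof. by rewrite /llo /= !powRr0 mulr1. Qed.

Lemma llo_adjust_itv (R : realType) (n : nat) (x : 'I_n -> R) (p : R * R) :
  (forall i, 0 < x i < 1) -> params p -> forall i, 0 < llo_adjust p x i < 1.
Proof. by move=> hx p0 i; exact: llo_itv. Qed.

Lemma likelihood_gt0 (R : realType) (n : nat) (x : 'I_n -> R) (y : 'I_n -> bool)
    (p : R * R) : (forall i, 0 < x i < 1) -> params p -> 0 < likelihood p x y.
Proof.
move=> hx p0; apply: prodr_gt0 => i _.
have /andP[l0 l1] := llo_itv p0 (hx i).
by rewrite mulr_gt0 // exprn_gt0 // subr_gt0.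
Qed.

Lemma likelihood_llo_adjust (R : realType) (n : nat) (x : 'I_n -> R)
    (y : 'I_n -> bool) (q p : R * R) :
  (forall i, 0 < x i < 1) -> params q -> params p ->
  likelihood q (llo_adjust p x) y = likelihood (llo_comp q p) x y.
Proof.
by move=> hx q0 p0; apply: eq_bigr => i _; rewrite /llo_adjust llo_llo.
Qed.

Lemma likelihood11_llo_adjust (R : realType) (n : nat) (x : 'I_n -> R)
    (y : 'I_n -> bool) (p : R * R) :
  (forall i, 0 < x i < 1) -> params p ->
  likelihood (1, 1) (llo_adjust p x) y = likelihood p x y.
Proof.
by move=> hx p0; rewrite likelihood_llo_adjust ?llo_comp1 // /params /= ltr01.
Qed.

(** * Existence of MLEs for adjusted predictions *)

(** If all outcomes agree, every factor is strictly monotone in delta in the same direction: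
    doubling delta (outcomes true) or halving it (outcomes false) beats any candidate. Since
    [0 < n], the product has a factor to make this strict. *)
Lemma mles_const_outcome (R : realType) (n : nat) (x : 'I_n -> R)
    (y : 'I_n -> bool) (b : bool) :
  (0 < n)%N -> (forall i, 0 < x i < 1) -> (forall i, y i = b) -> mles x y = set0.
Proof.
move=> n0 hx yb; rewrite -subset0 => -[d g] [/= d0 mx].
have half0 : 0 < d / 2 by rewrite divr_gt0.
have halfd : d / 2 < d by rewrite ltr_pdivrMr // ltr_pMr // ltr1n.
have d2 : d < d * 2 by rewrite ltr_pMr // ltr1n.
have dd0 : 0 < d * 2 by rewrite mulr_gt0.
case: b yb => yb.
- have := mx (d * 2, g) dd0; apply/negP; rewrite -ltNge.
  apply: ltr_prod => [|i _].
    by apply/hasP; exists (Ordinal n0); rewrite // mem_index_enum.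
  have /andP[l0 _] := @llo_itv _ (d, g) _ d0 (hx i).
  by rewrite yb !expr1 !expr0 !mulr1 (ltW l0) ltr_llo.
- have := mx (d / 2, g) half0; apply/negP; rewrite -ltNge.
  apply: ltr_prod => [|i _].
    by apply/hasP; exists (Ordinal n0); rewrite // mem_index_enum.
  have /andP[_ l1] := @llo_itv _ (d, g) _ d0 (hx i).
  by rewrite yb !expr1 !expr0 !mul1r subr_ge0 (ltW l1) ltrD2l ltrN2 ltr_llo.
Qed.

(** The polynomial [f] attains a maximum on the closed unit interval. It vanishes at 0 because of
    [i] and at 1 because of [j], but is positive at 1/2, so the maximizer is interior. *)
Lemma bernoulli_likelihood_max (R : realType) (n : nat) (y : 'I_n -> bool) (i j : 'I_n) :
  y i -> ~~ y j ->
  let f := fun t : R => \prod_(k < n) (t ^+ y k * (1 - t) ^+ (1 - y k)%N) in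
  exists2 t, 0 < t < 1 & forall s, 0 < s < 1 -> f s <= f t.
Proof.
move=> yi yj f.
pose P : {poly R} := \prod_(k < n) ('X ^+ y k * (1 - 'X) ^+ (1 - y k)%N).
have fP t : f t = P.[t].
  rewrite /P horner_prod; apply: eq_bigr => k _.
  by rewrite !hornerE.
have cf : {within `[0, 1], continuous f}.
  apply: continuous_subspaceT; rewrite (_ : f = horner P); last exact/funext.
  exact: continuous_horner.
have [t /itvP t01 tmax] := EVT_max ler01 cf.
have f0 : f 0 = 0.
  by rewrite /f (bigD1 i) //= yi expr1 !mul0r.
have f1 : f 1 = 0.
  by rewrite /f (bigD1 j) //= (negbTE yj) subrr expr1 mulr0 mul0r.
have fh : 0 < f (1 / 2).
  by apply: prodr_gt0 => k _; rewrite mulr_gt0 ?exprn_gt0 //; lra.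
have h01 : 1 / 2 \in `[0, 1 : R] by rewrite in_itv /=; apply/andP; split; lra.
have ft := lt_le_trans fh (tmax _ h01).
exists t.
  rewrite !lt_neqAle !t01 !andbT; apply/andP; split; apply/eqP => e.
    by move: ft; rewrite -e f0 ltxx.
  by move: ft; rewrite e f1 ltxx.
move=> s /andP[s0 s1]; apply: tmax; by rewrite in_itv /= !ltW.
Qed.

Lemma mles_llo_adjust_neq0 (R : realType) (n : nat) (x : 'I_n -> R)
    (y : 'I_n -> bool) (p : R * R) :
  (0 < n)%N -> (forall i, 0 < x i < 1) -> mles x y !=set0 -> params p ->
  mles (llo_adjust p x) y !=set0.
Proof.
move=> n0 hx [h hmle] p0; have [h0 hmax] := hmle.
have [g0|g0] := eqVneq p.2 0; last first.
  (* The MLE [h] of [x] is pulled back along adjustment by [p]. *)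
  have [q q0 qE] := llo_compK h0 p0 g0.
  exists q; split => // r r0; rewrite !likelihood_llo_adjust // qE.
  exact/hmax/llo_comp_params.
have noconst b : ~ forall i, y i = b.
  by move=> yb; move: hmle; rewrite (mles_const_outcome n0 hx yb).
have [i yi] : exists i, y i.
  apply: contrapT => /forallNP H; apply: (noconst false) => i.
  by apply/negbTE/negP/H.
have [j yj] : exists j, ~~ y j.
  apply: contrapT => /forallNP H; apply: (noconst true) => j.
  by apply/negPn/negP/H.
have [t /andP[t0 t1] tmax] := @bernoulli_likelihood_max R n y i j yi yj.
have u0 : 0 < 1 - t by rewrite subr_gt0.
have d0 : 0 < t / (1 - t) by rewrite divr_gt0.
have dE : t / (1 - t) / (t / (1 - t) + 1) = t.
  by field; rewrite subrKC oner_neq0 gt_eqF.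
(* With gamma = 0, [llo] is constantly delta / (delta + 1), which is [t] when delta is the odds of
   [t]. *)
exists (t / (1 - t), 0); split => // q q0.
rewrite likelihood_llo_adjust // /likelihood.
rewrite /llo_comp g0 mul0r.
under eq_bigr do rewrite llo0r.
under [leRHS]eq_bigr do rewrite llo0r dE.
apply: tmax.
have e0 : 0 < q.1 * p.1 `^ q.2 by rewrite mulr_gt0 // powR_gt0.
by rewrite divr_gt0 ?addr_gt0 //= ltr_pdivrMr ?addr_gt0 // mul1r ltrDl.
Qed.

(** * Bayes factor and posterior probability *)

Lemma mle_mles (R : realType) (n : nat) (z : 'I_n -> R) (y : 'I_n -> bool) :
  mles z y !=set0 -> mles z y (mle z y).
Proof. by case=> p hp; exact: (xgetI _ hp). Qed.

(** The penalty 2 log n, halved and negated in the exponent, becomes the factor 1 / n. *)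
Lemma BFE (R : realType) (n : nat) (z : 'I_n -> R) (y : 'I_n -> bool) :
  (0 < n)%N -> (forall i, 0 < z i < 1) -> mles z y !=set0 ->
  BF z y = likelihood (mle z y) z y / likelihood (1, 1) z y / n%:R.
Proof.
move=> n0 hz /mle_mles [m0 _].
have L0 := likelihood_gt0 y hz m0.
have L1 : 0 < likelihood (1, 1) z y by apply: likelihood_gt0; rewrite // /params /= ltr01.
have N0 : 0 < n%:R :> R by rewrite ltr0n.
rewrite -[RHS]lnK ?posrE ?divr_gt0 //.
rewrite !ln_div ?posrE ?divr_gt0 //.
by rewrite /BF /BIC_u /BIC_c; congr expR; field.
Qed.

Lemma BF_ge_invn (R : realType) (n : nat) (z : 'I_n -> R) (y : 'I_n -> bool) :
  (0 < n)%N -> (forall i, 0 < z i < 1) -> mles z y !=set0 ->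
  n%:R^-1 <= BF z y.
Proof.
move=> n0 hz zne; rewrite BFE //.
have p1 : params (1, 1 : R) by rewrite /params /= ltr01.
rewrite ler_peMl ?invr_ge0 // ler_pdivlMr ?likelihood_gt0 // mul1r.
by have [_] := mle_mles zne; apply.
Qed.

(** The bound says that the likelihood at (1, 1) is no smaller than the maximal one. *)
Lemma BF_le_invnP (R : realType) (n : nat) (z : 'I_n -> R) (y : 'I_n -> bool) :
  (0 < n)%N -> (forall i, 0 < z i < 1) -> mles z y !=set0 ->
  BF z y <= n%:R^-1 <-> mles z y (1, 1).
Proof.
move=> n0 hz zne; rewrite BFE //.
have p1 : params (1, 1 : R) by rewrite /params /= ltr01.
have [m0 mmax] := mle_mles zne.
rewrite ger_pMl ?invr_gt0 ?ltr0n // ler_pdivrMr ?likelihood_gt0 // mul1r.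
split=> [le|[_]]; last exact.
by split=> // q q0; apply: le_trans le; exact: mmax.
Qed.

(** With positive prior odds the posterior decreases strictly in the Bayes factor, so maximizing it
    amounts to minimizing [BF]. *)
Lemma posterior_calibrated_le (R : realType) (n : nat) (Pc Pu : R)
    (z w : 'I_n -> R) (y : 'I_n -> bool) : 0 < Pc -> 0 < Pu ->
  (posterior_calibrated Pc Pu z y <= posterior_calibrated Pc Pu w y) =
  (BF w y <= BF z y).
Proof.
move=> c0 u0; have r0 : 0 < Pu / Pc by rewrite divr_gt0.
have BF_gt0 (v : 'I_n -> R) : 0 < BF v y by exact: expR_gt0.
rewrite /posterior_calibrated; move: (BF z y) (BF w y) (BF_gt0 z) (BF_gt0 w).
move=> b b' b0 b'0.
rewrite !div1r lef_pV2; first by rewrite lerD2l ler_pM2r.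
all: by rewrite posrE addr_gt0 // mulr_gt0.
Qed.

Lemma mles_llo_adjust11 (R : realType) (n : nat) (x : 'I_n -> R)
    (y : 'I_n -> bool) (p : R * R) : (forall i, 0 < x i < 1) ->
  mles x y p -> mles (llo_adjust p x) y (1, 1).
Proof.
move=> hx [p0 pmax]; split=> [|q q0]; first by rewrite /params /= ltr01.
rewrite likelihood11_llo_adjust // likelihood_llo_adjust //.
exact/pmax/llo_comp_params.
Qed.

Lemma mles_of_llo_adjust11 (R : realType) (n : nat) (x : 'I_n -> R)
    (y : 'I_n -> bool) (p : R * R) : (forall i, 0 < x i < 1) ->
  params p -> p.2 != 0 -> mles (llo_adjust p x) y (1, 1) -> mles x y p.
Proof.
move=> hx p0 g0 [_ pmax]; split=> // r r0.
have [q q0 <-] := llo_compK r0 p0 g0.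
by rewrite -likelihood_llo_adjust // -(likelihood11_llo_adjust y hx p0); exact: pmax.
Qed.

Theorem mainTheorem1 (R : realType) (n : nat) (hn : (0 < n)%N)
    (x : 'I_n -> R) (hx : forall i, 0 < x i < 1) (y : 'I_n -> bool)
    (Pc Pu : R) (hPc : 0 < Pc) (hPu : 0 < Pu)
    (dhat ghat : R) (hmle : mles x y (dhat, ghat)) :
  let post := fun p : R * R => posterior_calibrated Pc Pu (llo_adjust p x) y in
  [/\ (forall p, params p -> mles (llo_adjust p x) y !=set0),
      argmax (@params R) post (dhat, ghat)
    & argmax (@params R) post `&` [set p | p.2 != 0] =
      mles x y `&` [set p | p.2 != 0] ].
Proof.
move=> post.
have ne p : params p -> mles (llo_adjust p x) y !=set0.
  by apply: mles_llo_adjust_neq0 => //; exists (dhat, ghat).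
have BFle p : mles x y p -> BF (llo_adjust p x) y <= n%:R^-1.
  move=> pmle; have [p0 _] := pmle.
  by apply/(BF_le_invnP hn (llo_adjust_itv hx p0) (ne _ p0)); exact: mles_llo_adjust11.
have mles_argmax p : mles x y p -> argmax (@params R) post p.
  move=> pmle; have [p0 _] := pmle; split=> [|q q0]; first exact: p0.
  rewrite /post (posterior_calibrated_le _ _ _ hPc hPu); apply: le_trans (BFle _ pmle) _.
  exact: (BF_ge_invn hn (llo_adjust_itv hx q0) (ne _ q0)).
split; [exact: ne|exact: mles_argmax|].
apply/seteqP; split=> p [pmax g0]; split; [|exact: g0|exact: mles_argmax|exact: g0].
(* Comparison with the given MLE, whose Bayes factor is at most 1 / n, bounds that of [p] by 1 / n
   too; so (1, 1) is an MLE after adjustment by [p], and [p.2 != 0] carries this back to [x]. *)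
have [p0 /(_ (dhat, ghat) hmle.1)] := pmax.
rewrite /post (posterior_calibrated_le _ _ _ hPc hPu) => le.
apply: (mles_of_llo_adjust11 hx p0 g0).
apply/(BF_le_invnP hn (llo_adjust_itv hx p0) (ne _ p0)).
exact: le_trans le (BFle _ hmle).
Qed.
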